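(* Let $\Gamma=\{14253,15243\}$. Then $$\mathrm{NM}_\Gamma(t,x,y)=\left(\frac{1}{U_\Gamma(t,y)}\right)^x,\qquad U_\Gamma(t,y)=1+\sum_{n\ge 1}U_{\Gamma,n}(y)\frac{t^n}{n!},$$ where the polynomials $U_{\Gamma,n}(y)$ are given by $U_{\Gamma,1}(y)=-y$ and, for $n\ge 2$, $$U_{\Gamma,n}(y)=(1-y)U_{\Gamma,n-1}(y)-y^2(n-3)\Big(U_{\Gamma,n-4}(y)+(1-y)(n-5)U_{\Gamma,n-5}(y)\Big)+y^3(n-3)(n-5)(n-6)U_{\Gamma,n-6}(y),$$ with the convention that in this recursion $U_{\Gamma,m}(y)=0$ for $m\le 0$.
   Context: $S_n$ is the set of permutations $\sigma=\sigma_1\cdots\sigma_n$ of $\{1,\dots,n\}$, written in one-line notation. $\mathrm{des}(\sigma)=|\{i:\sigma_i>\sigma_{i+1}\}|$. An entry $\sigma_j$ is a left-to-right minimum of $\sigma$ if $\sigma_i>\sigma_j$ for all $i<j$; $\mathrm{LRmin}(\sigma)$ is the number of left-to-right minima of $\sigma$. For a sequence of distinct positive integers $a_1\cdots a_m$, its reduction $\mathrm{red}(a_1\cdots a_m)\in S_m$ is obtained by replacing the $i$-th smallest entry by $i$. For a set $\Gamma$ of permutations, $\sigma$ has a $\Gamma$-match starting at position $i$ if $\mathrm{red}(\sigma_i\sigma_{i+1}\cdots\sigma_j)\in\Gamma$ for some $j>i$ (a match occupies consecutive positions). $\mathcal{NM}_n(\Gamma)$ is the set of $\sigma\in S_n$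 with no $\Gamma$-match. Define $$\mathrm{NM}_\Gamma(t,x,y)=\sum_{n\ge 0}\frac{t^n}{n!}\mathrm{NM}_{\Gamma,n}(x,y),\qquad \mathrm{NM}_{\Gamma,n}(x,y)=\sum_{\sigma\in\mathcal{NM}_n(\Gamma)}x^{\mathrm{LRmin}(\sigma)}y^{1+\mathrm{des}(\sigma)}\ (n\ge1),$$ with the $n=0$ term equal to $1$. All identities are between formal power series in $t$, and for a power series $F$ in $t$ with constant term $1$, $F^x=\exp(x\log F)$. *)

(* Defs.v *)
From mathcomp Require Import all_boot all_order all_fingroup all_algebra.
From mathcomp Require Export mpoly.

Set Implicit Arguments.
Unset Strict Implicit.
Unset Printing Implicit Defensive.

Import GRing.Theory.
Local Open Scope ring_scope.

(* ['S_n] permutes {0, ..., n-1}; the entries are shifted to {1, ..., n}. *)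
Definition word n (s : 'S_n) : seq nat := [seq (s i).+1 | i <- enum 'I_n].

(* Statistics and patterns on words of natural numbers; positions start at 0. *)
Definition des (w : seq nat) : nat :=
  #|[set i : 'I_(size w).-1 | nth 0 w i > nth 0 w i.+1]%N|.

Definition LRmin (w : seq nat) : nat :=
  #|[set j : 'I_(size w) |
      [forall i : 'I_(size w), (i < j) ==> (nth 0 w i > nth 0 w j)]%N]|.

Definition red (w : seq nat) : seq nat := [seq (index a (sort leq w)).+1 | a <- w].

(* The consecutive subword w_i ... w_j. *)
Definition factor (w : seq nat) (i j : nat) : seq nat :=
  take (j - i).+1 (drop i w).

Definition match_at (Gamma : seq (seq nat)) (w : seq nat) (i : nat) : bool :=
  [exists j : 'I_(size w), (i < j)%N && (red (factor w i j) \in Gamma)].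

Definition NMset (n : nat) (Gamma : seq (seq nat)) : {set 'S_n} :=
  [set s : 'S_n | [forall i : 'I_n, ~~ match_at Gamma (word s) i]].

Section FormalPowerSeries.

Variable R : comAlgType rat.

(* F n is the coefficient of t ^ n. *)
Definition series := nat -> R.

Implicit Types F G : series.

Definition sone : series := fun n => (n == 0)%:R.
Definition ssub F G : series := fun n => F n - G n.
Definition sscale (c : R) F : series := fun n => c * F n.
Definition smul F G : series := fun n => \sum_(i < n.+1) F i * G (n - i)%N.
Definition spow F (k : nat) : series := iter k (smul F) sone.

(* In the next three definitions the series raised to the power k has zero
   constant term, so its k-th power has no terms of degree < k; hence the
   coefficient of t ^ n only involves the powers k <= n.  *)

(* 1 / F, for F with constant term 1: the sum of the (1 - F) ^ k. *)
Definition sinv F : series := fun n => \sum_(k < n.+1) spow (ssub sone F) k n.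

(* log F, for F with constant term 1. *)
Definition slog F : series := fun n =>
  \sum_(1 <= k < n.+1) ((-1) ^+ k.-1 / k%:R : rat) *: spow (ssub F sone) k n.

(* exp G, for G with constant term 0. *)
Definition sexp G : series := fun n =>
  \sum_(k < n.+1) (k`!%:R^-1 : rat) *: spow G k n.

(* F ^ c, for F with constant term 1. *)
Definition srpow F (c : R) : series := sexp (sscale c (slog F)).

(* The exponential generating function 1 + \sum_(n >= 1) a_n t ^ n / n!. *)
Definition egf1 (a : nat -> R) : series := fun n =>
  if n is 0 then 1 else (n`!%:R^-1 : rat) *: a n.

End FormalPowerSeries.

(* Q[x, y]; vx and vy are the indeterminates x and y. *)
Notation Qxy := {mpoly rat[2]}.

Definition vx : Qxy := 'X_(@Ordinal 2 0 isT).
Definition vy : Qxy := 'X_(@Ordinal 2 1 isT).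

Definition NMpoly (Gamma : seq (seq nat)) (n : nat) : Qxy :=
  \sum_(s in NMset n Gamma) vx ^+ LRmin (word s) * vy ^+ (1 + des (word s)).

Definition NM (Gamma : seq (seq nat)) : series Qxy := egf1 (NMpoly Gamma).

Definition Gamma0 : seq (seq nat) := [:: [:: 1; 4; 2; 5; 3]; [:: 1; 5; 2; 4; 3]]%N.

(* Main.v *)
Require Import Defs.
From mathcomp Require Import all_boot all_order all_fingroup all_algebra.
From mathcomp Require Import zify ring.
From Stdlib Require Import FunctionalExtensionality.
Import GRing.Theory Num.Theory.
Local Open Scope ring_scope.

Set Implicit Arguments.
Unset Strict Implicit.
Unset Printing Implicit Defensive.

(** Five consecutive letters a b c d e form a match exactly when
    a < c < e < b, d; the two patterns are the two orders of b and d.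

    The exponent x. A match begins with its least letter, so in a word u m v
    with least letter m no match has a letter in u and a letter in m v; also m
    adds one left-to-right minimum, and the step into m is a descent. Hence the
    weight of u m v is the weight of u times x times a factor depending on m v
    only ([avoid_wt_min_split], [lrmin_min_split]). Placing the least letter in
    all possible ways gives NM' = x B NM, where the series B does not depend
    on x ([permsum_lr_wt_rec]). Comparing with the case x = 1 shows that NM is
    the x-th power of its value at x = 1 ([srpow_of_sderiv]).

    The case x = 1. This is the cluster method. Give the factor y to the last
    letter and to every descent, and split the factor 1 of every ascent as
    y + (1 - y): either the word is cut there, or the two letters are linked.
    Avoidance is imposed by inclusion-exclusion: sum over all sets of marked
    matches, with a sign -1 for each of them. Inside a marked match nothing is
    cut, so an ascent keeps its factor 1; outside, every descent is a cut. Every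
    word is then uniquely a concatenation of connected pieces, the clusters. For
    a single word this is [deconcat_avoid]; summed over all permutations it says
    that NM = 1 / (1 - W) ([permsum_avoid_wt]), with W the generating function
    of the clusters.

    Counting clusters. The first letter of a cluster is its least letter
    ([cluster_min]), because links go up and marked matches end above their
    first letter. So a cluster of length n is either a link followed by a
    cluster of length n - 1, or it starts with a marked match a b c d e, and
    then a, c, e are its three least letters. In the second case either c does
    not start a marked match, b and d are arbitrary, and what remains is a
    cluster from e on; or c starts one, b is arbitrary, and what remains is a
    cluster from c on that again starts with a marked match. This yields
    two coupled recurrences ([permsum_cluster_rec], [permsum_mcluster_rec]);
    eliminating the second sequence leaves the recursion of U_n up to the sign
    ([permsum_cluster_closed]), so U = 1 - W.

    All sums over permutations run over [permutations s] for a duplicate-free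
    list of letters s. Binomial coefficients are never produced by choosing
    subsets: shuffling the first i letters of a word leaves a sum over all
    permutations unchanged up to the factor i! ([sum_perms_shuffle]), which
    already gives the exponential generating function of a concatenation. *)

(** * Formal power series *)

Section Series.
Variable R : comAlgType rat.
Implicit Types F G H : series R.

(** A coefficient of a product of series only involves finitely many
    coefficients of the factors, so the ring laws and the Leibniz rule for
    series are inherited from polynomials. *)
Definition trunc N F : {poly R} := \poly_(i < N.+1) F i.

Lemma coef_trunc N F n : (n <= N)%N -> (trunc N F)`_n = F n.
Proof. by move=> le_nN; rewrite coef_poly ltnS le_nN. Qed.

Lemma coef_truncM N F G n :
  (n <= N)%N -> (trunc N F * trunc N G)`_n = smul F G n.
Proof.
move=> le_nN; rewrite coefM; apply: eq_bigr => i _.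
by rewrite !coef_trunc //; case: i => i /= ?; lia.
Qed.

Lemma smulC F G : smul F G = smul G F.
Proof.
apply: functional_extensionality => n.
by rewrite -!(@coef_truncM n) // mulrC.
Qed.

Lemma smulA F G H : smul F (smul G H) = smul (smul F G) H.
Proof.
apply: functional_extensionality => n.
have -> : smul F (smul G H) n = (trunc n F * (trunc n G * trunc n H))`_n.
  rewrite coefM; apply: eq_bigr => i _.
  by rewrite coef_truncM ?coef_trunc ?leq_subr // -ltnS.
rewrite mulrA coefM; apply: eq_bigr => i _.
by rewrite coef_truncM ?coef_trunc ?leq_subr // -ltnS.
Qed.

Lemma smul1s F : smul (sone R) F = F.
Proof.
apply: functional_extensionality => n.
rewrite /smul big_ord_recl /= mul1r subn0 big1 ?addr0 // => i _.
by rewrite /sone mul0r.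
Qed.

Lemma smulDl F G H :
  smul (fun n => F n + G n) H = (fun n => smul F H n + smul G H n).
Proof.
apply: functional_extensionality => n.
by rewrite /smul -big_split; apply: eq_bigr => i _; rewrite mulrDl.
Qed.

Lemma smul_scalel c F G : smul (sscale c F) G = sscale c (smul F G).
Proof.
apply: functional_extensionality => n.
by rewrite /smul /sscale mulr_sumr; apply: eq_bigr => i _; rewrite mulrA.
Qed.

Definition sderiv F : series R := fun n => F n.+1 *+ n.+1.

Lemma sderivM F G :
  sderiv (smul F G) = fun n => smul (sderiv F) G n + smul F (sderiv G) n.
Proof.
apply: functional_extensionality => n.
rewrite /sderiv -(@coef_truncM n.+1) // -coef_deriv derivM coefD !coefM.
congr (_ + _); apply: eq_bigr => i _; rewrite ?coef_deriv !coef_trunc //.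
all: by case: i => i /= ?; lia.
Qed.

Lemma sderiv_pow F k :
  sderiv (spow F k.+1) = fun n => smul (sderiv F) (spow F k) n *+ k.+1.
Proof.
elim: k => [|k IHk]; first by rewrite /= smulC smul1s smulC smul1s.
rewrite [spow F k.+2]/(smul F (spow F k.+1)) sderivM IHk.
apply: functional_extensionality => n.
rewrite [RHS]mulrS; congr (_ + _).
transitivity (smul F (smul (sderiv F) (spow F k)) n *+ k.+1).
  by rewrite /smul -sumrMnl; apply: eq_bigr => i _; rewrite mulrnAr.
by rewrite smulA [smul F (sderiv F)]smulC -smulA.
Qed.

Lemma spow_small F k n : F 0 = 0 -> (n < k)%N -> spow F k n = 0.
Proof.
move=> F0; elim: k n => // k IHk n lt_nk.
rewrite [spow _ _]/(smul F (spow F k)) /smul big_ord_recl F0 mul0r add0r.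
rewrite big1 // => i _.
by rewrite IHk ?mulr0 //; case: i => i /= lt_in; rewrite /bump /=; lia.
Qed.

(** Raising the bound of the sum changes nothing when the series powered
    has no constant term; a bound common to all the coefficients is what lets
    the sum over powers commute with [smul]. *)
Lemma sum_spow_widen (c : nat -> rat) F N n : F 0 = 0 -> (n <= N)%N ->
  \sum_(k < n.+1) c k *: spow F k n = \sum_(k < N.+1) c k *: spow F k n.
Proof.
move=> F0 le_nN.
rewrite (big_ord_widen N.+1 (fun k => c k *: spow F k n)) ?ltnS //.
rewrite big_mkcond; apply: eq_bigr => k _; case: ifP => // /negbT le_nk.
by rewrite spow_small ?scaler0 //; lia.
Qed.

Lemma smul_sum_spow (c : nat -> rat) F G n : F 0 = 0 ->
  smul G (fun n => \sum_(k < n.+1) c k *: spow F k n) n =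
  \sum_(k < n.+1) c k *: smul G (spow F k) n.
Proof.
move=> F0; rewrite /smul.
under eq_bigr => i _ do rewrite (sum_spow_widen c F0 (leq_subr i n)) mulr_sumr.
rewrite exchange_big; apply: eq_bigr => k _; rewrite scaler_sumr.
by apply: eq_bigr => i _; rewrite scalerAr.
Qed.

Lemma sderiv_sexp G : G 0 = 0 -> sderiv (sexp G) = smul (sderiv G) (sexp G).
Proof.
move=> G0; apply: functional_extensionality => n.
rewrite /sexp (smul_sum_spow (fun k => k`!%:R^-1)) //.
rewrite {1}/sderiv big_ord_recl mulrnDl [spow G ord0 _]/(0 : R) scaler0 mul0rn.
rewrite add0r.
rewrite -sumrMnl; apply: eq_bigr => k _.
rewrite scalerMnr -[spow _ _ _ *+ _]/(sderiv (spow G k.+1) n) sderiv_pow.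
rewrite -scalerMnr scalerMnl; congr (_ *: _).
rewrite factS natrM invfM -[LHS]mulr_natr mulrAC mulVf ?pnatr_eq0 // mul1r //.
Qed.

Lemma sinvE F n :
  sinv F n = \sum_(k < n.+1) (1 : rat) *: spow (ssub (sone R) F) k n.
Proof. by apply: eq_bigr => k _; rewrite scale1r. Qed.

(** The sum of the powers of A = 1 - F is the fixed point of S = 1 + A S. *)
Lemma smulV F : F 0 = 1 -> smul F (sinv F) = sone R.
Proof.
move=> F0; set A := ssub (sone R) F.
have A0 : A 0 = 0 by rewrite /A /ssub F0 subrr.
have rec : sinv F = fun n => sone R n + smul A (sinv F) n.
  apply: functional_extensionality => n.
  have -> : sinv F = fun n => \sum_(k < n.+1) (1 : rat) *: spow A k n.
    by apply: functional_extensionality => m; rewrite sinvE.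
  rewrite (smul_sum_spow (fun=> 1)) //.
  rewrite (sum_spow_widen (fun=> 1) A0 (leqnSn n)) big_ord_recl scale1r.
  by [].
have FE : F = fun n => sone R n + sscale (-1) A n.
  apply: functional_extensionality => n.
  by rewrite /sscale /A /ssub mulN1r opprB addrC subrK.
rewrite {1}FE smulDl smul1s smul_scalel; apply: functional_extensionality => n.
by rewrite {1}rec /sscale mulN1r addrK.
Qed.

(** The derivative of the k-th term of log F is (1 - F)^(k-1) F', so the sum is
    F' times the geometric series. *)
Lemma sderiv_slog F : F 0 = 1 -> sderiv (slog F) = smul (sderiv F) (sinv F).
Proof.
move=> F0; set A := ssub (sone R) F.
have A0 : A 0 = 0 by rewrite /A /ssub F0 subrr.
have B0 : ssub F (sone R) 0 = 0 by rewrite /ssub F0 subrr.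
have powB k : spow (ssub F (sone R)) k = sscale ((-1) ^+ k) (spow A k).
  elim: k => [|k IHk].
    by apply: functional_extensionality => n; rewrite /sscale mul1r.
  rewrite /= -/(spow _ k) IHk.
  have -> : ssub F (sone R) = sscale (-1) A.
    apply: functional_extensionality => n.
    by rewrite /sscale /A /ssub mulN1r opprB.
  rewrite smul_scalel smulC smul_scalel smulC.
  by apply: functional_extensionality => n; rewrite /sscale exprS mulrA.
have dB : sderiv (ssub F (sone R)) = sderiv F.
  apply: functional_extensionality => n.
  by rewrite /sderiv /ssub /sone /= subr0.
have -> : sinv F = fun n => \sum_(k < n.+1) (1 : rat) *: spow A k n.
  by apply: functional_extensionality => m; rewrite sinvE.
apply: functional_extensionality => n.
rewrite (smul_sum_spow (fun=> 1)) // {1}/sderiv /slog big_add1 big_mkord /=.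
rewrite -sumrMnl; apply: eq_bigr => k _.
rewrite scalerMnr -[smul _ _ _ *+ _]/(sderiv (spow _ k.+1) n) sderiv_pow.
rewrite dB powB -scalerMnr scalerMnl smulC smul_scalel smulC /sscale scale1r.
rewrite -[_ / _ *+ _]mulr_natr divfK ?pnatr_eq0 //.
rewrite -(signr_odd rat) -(signr_odd R) scaler_sign mulr_sign.
by case: (odd k); rewrite ?opprK.
Qed.

Lemma sderiv_srpow G c : G 0 = 1 ->
  sderiv (srpow G c) =
  smul (sscale c (smul (sderiv G) (sinv G))) (srpow G c).
Proof.
move=> G0; rewrite /srpow sderiv_sexp.
  rewrite -sderiv_slog //; congr smul; apply: functional_extensionality => n.
  by rewrite /sderiv /sscale mulrnAr.
by rewrite /sscale /slog big_nil mulr0.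
Qed.

Lemma mulrSn_inj n (a b : R) : a *+ n.+1 = b *+ n.+1 -> a = b.
Proof.
have scale c : c *+ n.+1 = (n.+1%:R : rat) *: c by rewrite scaler_nat.
by rewrite !scale; apply: scalerI; rewrite pnatr_eq0.
Qed.

Lemma sderiv_eq_uniq P F G : F 0 = G 0 ->
  sderiv F = smul P F -> sderiv G = smul P G -> F =1 G.
Proof.
move=> FG0 dF dG n; elim/ltn_ind: n => -[//|n] IHn.
apply: (@mulrSn_inj n); rewrite -/(sderiv F n) -/(sderiv G n) dF dG.
by apply: eq_bigr => i _; rewrite IHn // ltnS leq_subr.
Qed.

(** The equation for G says that B = G' / G is the logarithmic derivative of G,
    so F and G^c both solve the linear differential equation X' = c B X. *)
Lemma srpow_of_sderiv F G B c : F 0 = 1 -> G 0 = 1 ->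
  sderiv F = sscale c (smul B F) -> sderiv G = smul B G -> F =1 srpow G c.
Proof.
move=> F0 G0 dF dG.
have BE : smul (sderiv G) (sinv G) = B.
  by rewrite dG -smulA smulV // smulC smul1s.
apply: (@sderiv_eq_uniq (sscale c B)).
- by rewrite F0 /srpow /sexp big_ord1 /= /sone scale1r.
- by rewrite smul_scalel.
- by rewrite sderiv_srpow // BE.
Qed.

Lemma sinv_of_smul F G : F 0 = 1 -> smul F G = sone R -> sinv F = G.
Proof.
move=> F0 FG; rewrite -[LHS]smul1s -FG smulC smulA [smul _ F]smulC smulV //.
by rewrite smul1s.
Qed.
End Series.

(** * Sums over the permutations of a list *)

Section SumsOverPermutations.
Variable R : comNzRingType.
Implicit Types (F G H : seq nat -> R) (s t u w : seq nat).

Lemma size_perms s w : w \in permutations s -> size w = size s.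
Proof. by rewrite mem_permutations => /perm_size. Qed.

Lemma perms_uniq s w : uniq s -> w \in permutations s -> uniq w.
Proof. by rewrite mem_permutations => us /perm_uniq->. Qed.

(** Deleting the letter m is a bijection once its position is prescribed. *)
Lemma permutations_index m s i : uniq (m :: s) -> (i <= size s)%N ->
  perm_eq [seq w <- permutations (m :: s) | index m w == i]
          [seq take i w ++ m :: drop i w | w <- permutations s].
Proof.
move=> us le_is; apply: uniq_perm.
- exact/filter_uniq/permutations_uniq.
- rewrite map_inj_in_uniq ?permutations_uniq // => w1 w2 /size_perms s1.
  move=> /size_perms s2 /eqP; rewrite eqseq_cat ?size_take ?s1 ?s2 //.
  case/andP=> /eqP et; rewrite eqseq_cons eqxx => /eqP ed.
  by rewrite -(cat_take_drop i w1) et ed cat_take_drop.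
move=> w; rewrite mem_filter mem_permutations; apply/andP/mapP.
  case=> /eqP iw pw.
  have mw : m \in w by rewrite (perm_mem pw) mem_head.
  have lt_iw : (i < size w)%N by rewrite -iw index_mem.
  have wE : w = take i w ++ m :: drop i.+1 w.
    by rewrite -[in m :: _](nth_index m mw) iw -drop_nth // cat_take_drop.
  have st : size (take i w) = i by rewrite size_takel // ltnW.
  exists (take i w ++ drop i.+1 w).
    rewrite mem_permutations -(perm_cons m) -(permPr pw).
    rewrite [in X in perm_eq _ X]wE.
    by rewrite -cat1s perm_catCA.
  by rewrite take_cat drop_cat st ltnn subnn take0 drop0 cats0 -wE.
case=> v; rewrite mem_permutations => pv ->; split; last first.
  by rewrite -cat1s perm_catCA cat_take_drop /= perm_cons.
rewrite index_cat; case: ifP => [/mem_take|_].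
  by rewrite (perm_mem pv); case/andP: us => /negbTE->.
by rewrite size_takel ?(perm_size pv) //= eqxx addn0.
Qed.

Lemma sum_perms_insert H m s : uniq (m :: s) ->
  \sum_(w <- permutations (m :: s)) H w =
  \sum_(w <- permutations s)
    \sum_(i < (size s).+1) H (take i w ++ m :: drop i w).
Proof.
move=> us; rewrite exchange_big /=.
under [RHS]eq_bigr => i _ do
  rewrite -(big_map (fun w => take i w ++ m :: drop i w) xpredT)
          -(perm_big _ (permutations_index us (ltn_ord i : i <= size s)%N))
          big_filter.
rewrite (exchange_big_dep xpredT) //= !big_seq; apply: eq_bigr => w ws.
have iw : (index m w < (size s).+1)%N.
  rewrite -[(size s).+1]/(size (m :: s)) -(size_perms ws) index_mem.
  by move: ws; rewrite mem_permutations => /perm_mem->; rewrite mem_head.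
by rewrite (big_pred1 (Ordinal iw)) // => i; rewrite eq_sym.
Qed.

(** When H forces the position k of the letter m, only one insertion survives;
    this is how the known places of the least letters of a cluster are used. *)
Lemma sum_perms_supported H m s k : uniq (m :: s) -> (k <= size s)%N ->
  (forall w, w \in permutations (m :: s) -> index m w != k -> H w = 0) ->
  \sum_(w <- permutations (m :: s)) H w =
  \sum_(w <- permutations s) H (take k w ++ m :: drop k w).
Proof.
move=> us le_ks H0; rewrite (bigID (fun w => index m w == k)) /=.
rewrite [X in _ + X]big_seq_cond [X in _ + X]big1 ?addr0; last first.
  by move=> w /andP[]; apply: H0.
by rewrite -big_filter (perm_big _ (permutations_index us le_ks)) big_map.
Qed.

Lemma sum_perms_head H m s : uniq (m :: s) ->
  (forall w, w \in permutations (m :: s) -> index m w != 0%N -> H w = 0) ->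
  \sum_(w <- permutations (m :: s)) H w = \sum_(w <- permutations s) H (m :: w).
Proof.
move=> us H0; rewrite (sum_perms_supported us _ H0) //.
by apply: eq_bigr => w _; rewrite take0 drop0.
Qed.

(** Two permutations of s are in the same class when they agree outside the
    positions i, ..., i + k - 1. The inner sum is a sum over the class of w, and
    every class has k! elements. *)
Lemma sum_perms_shuffle H i k s : uniq s -> (i + k <= size s)%N ->
  \sum_(w <- permutations s) \sum_(u <- permutations (take k (drop i w)))
     H (take i w ++ u ++ drop (i + k) w) =
  (\sum_(w <- permutations s) H w) *+ k`!.
Proof.
move=> us le_s.
pose K w := (take i w, drop (i + k) w).
have class w H' : w \in permutations s ->
    \sum_(u <- permutations (take k (drop i w)))
       H' (take i w ++ u ++ drop (i + k) w) =
    \sum_(v <- permutations s | K v == K w) H' v :> R.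
  move=> ws; have sw := size_perms ws; have uw := perms_uniq us ws.
  have wE : w = take i w ++ take k (drop i w) ++ drop (i + k) w.
    by rewrite addnC -drop_drop !cat_take_drop.
  rewrite -(big_map (fun u => take i w ++ u ++ drop (i + k) w) xpredT).
  rewrite -[RHS]big_filter; apply: perm_big; apply: uniq_perm.
  - rewrite map_inj_in_uniq ?permutations_uniq // => u1 u2 _ _ /eqP.
    rewrite eqseq_cat // eqxx => /eqP /(congr1 rev); rewrite !rev_cat => /eqP.
    by rewrite eqseq_cat // eqxx => /eqP/(can_inj revK).
  - exact/filter_uniq/permutations_uniq.
  move: ws; rewrite mem_permutations => ws.
  have st : size (take i w) = i by rewrite size_takel // sw; lia.
  have sk : size (take k (drop i w)) = k.
    by rewrite size_takel // size_drop sw; lia.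
  move=> v; rewrite mem_filter mem_permutations; apply/mapP/andP.
    case=> u; rewrite mem_permutations => pu ->; split; last first.
      rewrite -(permPr ws) [X in perm_eq _ X]wE.
      by rewrite perm_cat2l perm_cat2r.
    have su : size u = k by rewrite (perm_size pu).
    rewrite xpair_eqE take_size_cat ?eqxx //= addnC -drop_drop.
    by rewrite drop_size_cat // drop_size_cat.
  case=> /eqP[ti di] pv; exists (take k (drop i v)).
    have := permPr ws v; rewrite pv {1}wE => /esym.
    rewrite -[X in perm_eq X](cat_take_drop i) ti perm_cat2l.
    rewrite -[X in perm_eq X](cat_take_drop k) drop_drop addnC di perm_cat2r.
    by rewrite mem_permutations.
  by rewrite -ti -di addnC -drop_drop !cat_take_drop.
under eq_big_seq => w ws do rewrite class //.
rewrite (exchange_big_dep xpredT) //= -sumrMnl big_seq [RHS]big_seq.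
apply: eq_bigr => v vs; under eq_bigl => w do rewrite eq_sym.
rewrite -(class v (fun=> H v)) // big_const_seq count_predT iter_addr_0.
rewrite size_permutations; last first.
  by rewrite take_uniq ?drop_uniq ?(perms_uniq us vs).
by rewrite size_takel // size_drop (size_perms vs); lia.
Qed.

(** Shuffle the first i letters and then the last ones: each time one of the two
    factors is replaced by its sum over all rearrangements, a constant. *)
Lemma sum_perms_cat F G a b s i : uniq s -> (i <= size s)%N ->
  (forall t, uniq t -> {subset t <= s} -> size t = i ->
     \sum_(u <- permutations t) F u = a) ->
  (forall t, uniq t -> {subset t <= s} -> size t = (size s - i)%N ->
     \sum_(u <- permutations t) G u = b) ->
  (\sum_(w <- permutations s) F (take i w) * G (drop i w))
    *+ (i`! * (size s - i)`!) = (a * b) *+ (size s)`!.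
Proof.
move=> us le_is Fa Gb; rewrite mulrnA.
rewrite -(@sum_perms_shuffle _ 0 i) //.
transitivity ((\sum_(w <- permutations s) a * G (drop i w)) *+ (size s - i)`!).
  congr (_ *+ _); apply: eq_big_seq => w ws; rewrite drop0 take0 add0n.
  have sw := size_perms ws.
  transitivity (\sum_(u <- permutations (take i w)) F u * G (drop i w)).
    apply: eq_big_seq => u /size_perms; rewrite size_takel ?sw // => su /=.
    by rewrite take_size_cat // drop_size_cat.
  rewrite -mulr_suml Fa ?size_takel ?sw //.
    by rewrite take_uniq // (perms_uniq us ws).
  by move=> x /mem_take; move: ws; rewrite mem_permutations => /perm_mem->.
rewrite -(@sum_perms_shuffle _ i (size s - i)) // ?subnKC //.
transitivity (\sum_(w <- permutations s) a * b).
  apply: eq_big_seq => w ws; have sw := size_perms ws.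
  rewrite (@take_oversize _ _ (drop i w)) ?size_drop ?sw //.
  rewrite (@drop_oversize _ (size s)) ?sw //.
  transitivity (\sum_(u <- permutations (drop i w)) a * G u).
    apply: eq_big_seq => u _; rewrite cats0 drop_size_cat // size_takel //.
    by rewrite sw.
  rewrite -mulr_sumr Gb ?size_drop ?sw //.
    by rewrite drop_uniq // (perms_uniq us ws).
  by move=> x /mem_drop; move: ws; rewrite mem_permutations => /perm_mem->.
by rewrite big_const_seq count_predT iter_addr_0 size_permutations.
Qed.

(** The value only depends on the relative order of the letters. *)
Definition order_invariant F :=
  forall g w, {in w &, {mono g : a b / (a < b)%N}} -> F (map g w) = F w.

Definition permsum F n := \sum_(w <- permutations (iota 0 n)) F w.

Lemma permutations_map (g : nat -> nat) s : uniq s -> {in s &, injective g} ->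
  perm_eq (permutations (map g s)) (map (map g) (permutations s)).
Proof.
move=> us ig; rewrite perm_sym.
have um : uniq (map (map g) (permutations s)).
  rewrite map_inj_in_uniq ?permutations_uniq // => w1 w2.
  rewrite !mem_permutations => p1 p2.
  apply: (@inj_in_map _ _ g (mem s)) => //.
  - by apply/allP => x; rewrite (perm_mem p1).
  - by apply/allP => x; rewrite (perm_mem p2).
have sub : {subset map (map g) (permutations s) <= permutations (map g s)}.
  move=> _ /mapP[w ws ->]; move: ws; rewrite !mem_permutations.
  exact: perm_map.
apply: uniq_perm => //; first exact: permutations_uniq.
apply: (uniq_min_size um sub _).2.
by rewrite size_map !size_permutations ?size_map // map_inj_in_uniq.
Qed.

(** The sorted list of the letters of s, seen as a map from positions to
    letters, is an increasing bijection from iota 0 (size s) onto s. *)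
Lemma sum_perms_invariant F s : order_invariant F -> uniq s ->
  \sum_(w <- permutations s) F w = permsum F (size s).
Proof.
move=> invF us; set t := sort leq s.
have pst : perm_eq s t by rewrite perm_sym perm_sort.
have -> : permsum F (size s) = permsum F (size t) by rewrite (perm_size pst).
rewrite (perm_big _ (perm_permutations pst)).
have tE : t = map (nth 0%N t) (iota 0 (size t)).
  by rewrite -[LHS](mkseq_nth 0%N).
have lt_t : sorted ltn t.
  by rewrite ltn_sorted_uniq_leq sort_uniq us sort_sorted //; apply: leq_total.
have mono : {in iota 0 (size t) &, {mono nth 0%N t : a b / (a < b)%N}}.
  move=> a b; rewrite !mem_iota /= !add0n => la lb.
  have homo := sorted_ltn_nth ltn_trans 0%N lt_t.
  case: (ltngtP a b) => [ab|ba|->]; last by rewrite ltnn.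
    exact: homo.
  by rewrite ltnNge ltnW // homo.
rewrite {1}tE (perm_big _ (permutations_map _ _)) ?iota_uniq //; last first.
  move=> a b ai bi eab; have := mono a b ai bi; have := mono b a bi ai.
  by rewrite eab ltnn; lia.
rewrite big_map; apply: eq_big_seq => w; rewrite mem_permutations => pw.
by apply: invF => a b; rewrite !(perm_mem pw); apply: mono.
Qed.

End SumsOverPermutations.

(** * Weights of words *)

Definition starts_match (w : seq nat) : bool :=
  if w is [:: a, b, c, d, e & _] then [&& a < c, c < e, e < b & e < d]%N
  else false.

Section Weights.
Variables (R : comAlgType rat) (x y : R).
Implicit Types (F G : seq nat -> R) (u v w : seq nat).

(** This is y ^ (1 + des w) on a nonempty word with distinct letters and no
    match, and 0 on a word with a match ([avoid_wtE_des]). *)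
Fixpoint avoid_wt w : R :=
  if w is a :: w1 then
    if starts_match w then 0
    else if w1 is b :: _ then (if (a < b)%N then 1 else y) * avoid_wt w1 else y
  else 1.

(** The signed weights of the clusters on the word w: of all of them, and of
    those in which a match is marked at the first letter. They are computed
    together because each needs the other on shorter words. Two marked matches
    can overlap only by starting two or four positions apart, since a match
    starts with an ascent and its second and fourth steps are descents. When the
    first two marked matches start at a and c, the factor - y of the first one
    accounts for its sign and for the descent from b to c; otherwise the factor
    is - y ^ 2, for the two descents from b to c and from d to e. *)
Fixpoint cluster_wts w : R * R :=
  if w is a :: w1 then
    if w1 is b :: w2 then
      let v :=
        if starts_match w then
          if w2 is c :: w3 then
            if w3 is d :: w4 then
              - (y ^+ 2 * (cluster_wts w4).1 + y * (cluster_wts w2).2)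
            else 0
          else 0
        else 0 in
      ((if (a < b)%N then (1 - y) * (cluster_wts w1).1 else 0) + v, v)
    else (y, 0)
  else (0, 0).

Definition cluster w := (cluster_wts w).1.
Definition mcluster w := (cluster_wts w).2.

Lemma clusterE a b w : cluster [:: a, b & w] =
  (if (a < b)%N then (1 - y) * cluster (b :: w) else 0) +
  mcluster [:: a, b & w].
Proof. by []. Qed.

Lemma mclusterE a b c d e w : mcluster [:: a, b, c, d, e & w] =
  if starts_match [:: a, b, c, d, e & w] then
    - (y ^+ 2 * cluster (e :: w) + y * mcluster [:: c, d, e & w])
  else 0.
Proof. by []. Qed.

Lemma mcluster_short w : (size w < 5)%N -> mcluster w = 0.
Proof. by case: w => [|a [|b [|c [|d [|e w]]]]]. Qed.

Lemma starts_match_lt a b w : starts_match [:: a, b & w] -> (a < b)%N.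
Proof. by case: w => [|c [|d [|e w]]] //= /and4P[]; lia. Qed.

Lemma avoid_wtE a b w : avoid_wt [:: a, b & w] =
  if starts_match [:: a, b & w] then 0
  else (if (a < b)%N then 1 else y) * avoid_wt (b :: w).
Proof. by []. Qed.

Lemma avoid_wt_desc a b w : (b <= a)%N ->
  avoid_wt [:: a, b & w] = y * avoid_wt (b :: w).
Proof.
move=> le_ba; rewrite avoid_wtE.
have /negbTE-> : ~~ starts_match [:: a, b & w].
  by apply/negP => /starts_match_lt; lia.
by rewrite ltnNge le_ba.
Qed.

Lemma avoid_wt_asc a b w : (a < b)%N ->
  avoid_wt [:: a, b & w] =
  if starts_match [:: a, b & w] then 0 else avoid_wt (b :: w).
Proof. by move=> lt_ab; rewrite avoid_wtE lt_ab mul1r. Qed.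

(** The convolution over all factorizations w = u v; the recursive form peels
    letters from the left, as the weights do. *)
Fixpoint deconcat F G w : R :=
  F [::] * G w +
  if w is a :: w1 then deconcat (fun u => F (a :: u)) G w1 else 0.

Lemma deconcat_cons F G a w : deconcat F G (a :: w) =
  F [::] * G (a :: w) + deconcat (fun u => F (a :: u)) G w.
Proof. by []. Qed.

Lemma deconcatE F G w :
  deconcat F G w = \sum_(i < (size w).+1) F (take i w) * G (drop i w).
Proof.
elim: w F => [|a w IHw] F; first by rewrite big_ord1 /= addr0.
by rewrite [LHS]/= IHw [RHS]big_ord_recl.
Qed.

Lemma eq_deconcat F F' G w : F =1 F' -> deconcat F G w = deconcat F' G w.
Proof.
by move=> FF'; rewrite !deconcatE; apply: eq_bigr => i _; rewrite FF'.
Qed.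

Lemma deconcat_lin (k l : R) F F' G w :
  deconcat (fun u => k * F u + l * F' u) G w =
  k * deconcat F G w + l * deconcat F' G w.
Proof.
rewrite !deconcatE !mulr_sumr -big_split; apply: eq_bigr => i _.
by rewrite /= mulrDl !mulrA.
Qed.

(** The first component says that the first cluster of a cut and marked word can
    be split off. For the second one, suppose that w starts with a match. The
    contributions in which it is marked must cancel those in which it is not,
    and the latter add up to the weight of w without its first letter, the first
    step being an ascent, of weight 1. Both are proved together by induction on
    the length. *)
Lemma deconcat_avoid w :
  deconcat cluster avoid_wt w = (if w is [::] then 0 else avoid_wt w) /\
  deconcat mcluster avoid_wt w =
    if starts_match w then - avoid_wt (behead w) else 0.
Proof.
have [n] := ubnP (size w); elim: n w => // n IHn [_|a [_|b w]].
- by rewrite /= !mul0r !addr0.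
- by rewrite /= !mul0r !mulr1 !add0r !addr0.
rewrite ltnS => lt_n.
have top : deconcat mcluster avoid_wt [:: a, b & w] =
    if starts_match [:: a, b & w] then - avoid_wt (b :: w) else 0.
  case: w lt_n => [|c [|d [|e w]]] lt_n.
  - by rewrite /= !mul0r !addr0.
  - by rewrite /= !mul0r !addr0.
  - by rewrite /= !mul0r !addr0.
  rewrite [LHS]/= !mul0r !add0r; set m := starts_match _.
  case: (boolP m) => [mt|/negbTE mf]; last first.
    rewrite (@eq_deconcat _ (fun u => 0 * 0 + 0 * 0)).
      by rewrite (deconcat_lin 0 0 (fun=> 0) (fun=> 0)) !mul0r addr0.
    by move=> u; rewrite mclusterE [starts_match _]mf !mul0r addr0.
  rewrite (@eq_deconcat _
    (fun u => - y ^+ 2 * cluster (e :: u) + - y * mcluster [:: c, d, e & u]));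
    last by move=> u; rewrite mclusterE [starts_match _]mt opprD !mulNr.
  rewrite (deconcat_lin _ _ (fun u => cluster (e :: u))
                            (fun u => mcluster [:: c, d, e & u])).
  have [IHe _] := IHn (e :: w) ltac:(by move: lt_n => /=; lia).
  have [_ IHc] := IHn [:: c, d, e & w] ltac:(by move: lt_n => /=; lia).
  have -> : deconcat (fun u => cluster (e :: u)) avoid_wt w = avoid_wt (e :: w).
    by rewrite -IHe /= mul0r add0r.
  have -> : deconcat (fun u => mcluster [:: c, d, e & u]) avoid_wt w =
      if starts_match [:: c, d, e & w] then - avoid_wt [:: d, e & w] else 0.
    by rewrite -[RHS]IHc /= !mul0r !add0r.
  case/and4P: mt => ac ce eb ed.
  (* No match starts at b or d, which are followed by descents. If one starts
     at c, the two terms cancel, in agreement with the vanishing of the weight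
     of the remaining word. *)
  rewrite (@avoid_wt_desc b c) ?(@avoid_wt_asc c d) ?(@avoid_wt_desc d e);
    try lia.
  by case: ifP => _; ring.
split=> //.
move: top; rewrite !deconcat_cons !mul0r !add0r => top.
have [IHb _] := IHn (b :: w) lt_n.
rewrite (@eq_deconcat _ (fun u => (if (a < b)%N then 1 - y else 0) *
  cluster (b :: u) + 1 * mcluster [:: a, b & u])); last first.
  by move=> u; rewrite clusterE mul1r; case: ifP => //; rewrite mul0r.
rewrite (deconcat_lin _ _ (fun u => cluster (b :: u))
                          (fun u => mcluster [:: a, b & u])) top.
move: IHb; rewrite deconcat_cons mul0r add0r => ->; rewrite avoid_wtE.
rewrite -[cluster [:: a]]/y.
case: (boolP (starts_match _)) => [/starts_match_lt->|_]; first by ring.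
by case: ifP => _; ring.
Qed.

(** A match that starts in u and reaches m would have m above its own first
    letter. *)
Lemma avoid_wt_min_split u m v : all (ltn m) u ->
  avoid_wt (u ++ m :: v) = avoid_wt u * avoid_wt (m :: v).
Proof.
elim: u => [|a u IHu]; first by rewrite mul1r.
case/andP=> ma mu; rewrite /= in ma.
have sE : starts_match (a :: u ++ m :: v) = starts_match (a :: u).
  move: mu; case: u {IHu} => [|b [|c [|d [|e u]]]] //= H; apply/negbTE.
  - by case: v => [|c [|d [|e v]]] //; apply/negP; lia.
  - by case: v => [|d [|e v]] //; apply/negP; lia.
  - by case: v => [|e v] //; apply/negP; lia.
  - by apply/negP; lia.
case: u mu sE IHu => [|b u] mu sE IHu.
  by rewrite cat_cons cat0s [LHS]avoid_wtE [starts_match _]sE ltnNge ltnW.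
rewrite !cat_cons [LHS]avoid_wtE [starts_match _]sE avoid_wtE.
by case: ifP => _; rewrite ?mul0r // -mulrA -IHu.
Qed.

(** The successive links and marked matches of a cluster climb from the first
    letter, and the remaining letters of a marked match lie above its end. *)
Lemma cluster_min a w : ~~ all (ltn a) w ->
  cluster (a :: w) = 0 /\ mcluster (a :: w) = 0.
Proof.
have [n] := ubnP (size w); elim: n a w => // n IHn a [|b w] //.
rewrite ltnS => lt_n nmin.
have top : mcluster [:: a, b & w] = 0.
  case: w lt_n nmin => [|c [|d [|e w]]] // lt_n nmin; rewrite mclusterE.
  case: ifP => // /and4P[ac ce eb ed].
  have nw : ~~ all (ltn a) w.
    have [ab [ad ae]] : (a < b /\ a < d /\ a < e)%N by lia.
    by move: nmin; rewrite /= ab ac ad ae.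
  have ne : ~~ all (ltn e) w.
    by apply: contra nw; apply: sub_all => z /=; lia.
  have nc : ~~ all (ltn c) [:: d, e & w].
    by apply: contra nw => /= /and3P[_ _]; apply: sub_all => z /=; lia.
  have [-> _] := IHn e w ltac:(by move: lt_n => /=; lia) ne.
  have [_ ->] := IHn c [:: d, e & w] ltac:(by move: lt_n => /=; lia) nc.
  by rewrite !mulr0 addr0 oppr0.
split=> //; rewrite clusterE top addr0; case: ifP => // ab.
have [||-> _] := IHn b w; rewrite ?mulr0 //.
by apply: contra nmin => /= bw; rewrite ab; apply: sub_all bw => z /=; lia.
Qed.

(** What follows a marked match a b c d e is a cluster starting at e or at c, so
    its letters are above e or above c. *)
Lemma mcluster_min2 a b c w :
  mcluster [:: a, b, c & w] != 0 -> all (ltn c) (b :: w).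
Proof.
case: w => [|d [|e w]]; rewrite ?eqxx // mclusterE.
case: ifP => [/and4P[ac ce eb ed]|]; last by rewrite eqxx.
apply: contraR => nmin.
have nw : ~~ all (ltn c) w.
  have [cb cd] : (c < b /\ c < d)%N by lia.
  by move: nmin; rewrite /= cb cd ce.
have [-> _] : cluster (e :: w) = 0 /\ mcluster (e :: w) = 0.
  by apply: cluster_min; apply: contra nw; apply: sub_all => z /=; lia.
have [_ ->] : cluster [:: c, d, e & w] = 0 /\ mcluster [:: c, d, e & w] = 0.
  by apply: cluster_min; apply: contra nw => /= /and3P[].
by rewrite !mulr0 addr0 oppr0.
Qed.

Lemma mcluster_min3 a b c d e w :
  mcluster [:: a, b, c, d, e & w] != 0 -> all (ltn e) [:: b, d & w].
Proof.
rewrite mclusterE; case: ifP => [/and4P[ac ce eb ed]|]; last by rewrite eqxx.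
apply: contraR => /=; rewrite eb ed /= => nw.
have [-> _] := cluster_min nw.
case: (eqVneq (mcluster [:: c, d, e & w]) 0) => [->|/mcluster_min2].
  by rewrite !mulr0 addr0 oppr0.
by rewrite /= (negbTE nw) andbF.
Qed.

Lemma starts_match_map (g : nat -> nat) w :
  {in w &, {mono g : a b / (a < b)%N}} ->
  starts_match (map g w) = starts_match w.
Proof.
case: w => [|a [|b [|c [|d [|e w]]]]] //= mono.
by rewrite !mono ?inE ?eqxx ?orbT.
Qed.

Lemma cluster_wts_map (g : nat -> nat) w :
  {in w &, {mono g : a b / (a < b)%N}} -> cluster_wts (map g w) = cluster_wts w.
Proof.
have [n] := ubnP (size w); elim: n w => // n IHn [|a [|b w]] // lt_n mono.
have IH u : (size u < n)%N -> {subset u <= [:: a, b & w]} ->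
    cluster_wts (map g u) = cluster_wts u.
  by move=> lt_u sub; apply: IHn => // p q /sub up /sub uq; apply: mono.
have top : mcluster (map g [:: a, b & w]) = mcluster [:: a, b & w].
  case: w lt_n mono IH => [|c [|d [|e w]]] // lt_n mono IH.
  have -> : mcluster (map g [:: a, b, c, d, e & w]) =
      if starts_match (map g [:: a, b, c, d, e & w]) then
        - (y ^+ 2 * cluster (map g (e :: w)) +
           y * mcluster (map g [:: c, d, e & w]))
      else 0 by [].
  rewrite starts_match_map // mclusterE /cluster /mcluster.
  rewrite !IH //; try by move: lt_n => /=; lia.
  - by move=> z; rewrite !inE => /or3P[->|->|->]; rewrite ?orbT.
  - by move=> z; rewrite !inE => /orP[->|->]; rewrite ?orbT.
rewrite [LHS]surjective_pairing [RHS]surjective_pairing.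
rewrite -!/(cluster _) -!/(mcluster _) top; congr pair.
have -> : cluster (map g [:: a, b & w]) =
    (if (g a < g b)%N then (1 - y) * cluster (map g (b :: w)) else 0) +
    mcluster (map g [:: a, b & w]) by [].
rewrite top clusterE mono ?inE ?eqxx ?orbT // /cluster IH //.
by move=> z; rewrite !inE => ->; rewrite orbT.
Qed.

Lemma cluster_invariant : order_invariant cluster.
Proof. by move=> g w mono; rewrite /cluster cluster_wts_map. Qed.

Lemma mcluster_invariant : order_invariant mcluster.
Proof. by move=> g w mono; rewrite /mcluster cluster_wts_map. Qed.

Lemma avoid_wt_invariant : order_invariant avoid_wt.
Proof.
move=> g; elim=> [|a [|b w] IHw] // mono.
have -> : avoid_wt (map g [:: a, b & w]) =
    if starts_match (map g [:: a, b & w]) then 0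
    else (if (g a < g b)%N then 1 else y) * avoid_wt (map g (b :: w)) by [].
rewrite starts_match_map // avoid_wtE mono ?inE ?eqxx ?orbT // IHw //.
by move=> p q pw qw; apply: mono; rewrite inE ?pw ?qw orbT.
Qed.

Definition lrmin w : nat :=
  (\sum_(0 <= j < size w) all (fun b => nth 0 w j < b) (take j w))%N.

Lemma lrmin_min_split u m v : all (ltn m) u -> all (ltn m) v ->
  lrmin (u ++ m :: v) = (lrmin u).+1.
Proof.
move=> mu mv; rewrite /lrmin size_cat.
rewrite (@big_cat_nat _ _ _ (size u)) ?leq_addr //=.
rewrite -[RHS]addn1; congr (_ + _)%N.
  apply: eq_big_nat => j /andP[_ lt_j].
  by rewrite nth_cat take_cat lt_j.
rewrite big_ltn ?addnS ?ltnS ?leq_addr // nth_cat take_cat ltnn subnn /= cats0.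
rewrite (_ : all _ u) // big_nat_cond big1 // => j /andP[/andP[lt_j ltj] _].
apply/eqP; rewrite eqb0 nth_cat take_cat ltnNge (ltnW lt_j) /=.
case: j lt_j ltj => // j lt_j ltj; rewrite subSn //= all_cat /=.
have -> : (nth 0 v (j - size u) < m)%N = false; last by rewrite !andbF.
apply/negbTE; rewrite -leqNgt ltnW //.
by apply: (all_nthP 0%N mv); rewrite ltn_subLR //; lia.
Qed.

Lemma lrmin_map (g : nat -> nat) w : {in w &, {mono g : a b / (a < b)%N}} ->
  lrmin (map g w) = lrmin w.
Proof.
move=> mono; rewrite /lrmin size_map; apply: eq_big_nat => j /andP[_ lt_j].
rewrite (nth_map 0%N) // -map_take all_map; congr nat_of_bool.
by apply: eq_in_all => b /mem_take bw /=; rewrite mono // mem_nth.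
Qed.

Definition lr_wt w : R := x ^+ lrmin w * avoid_wt w.

Lemma lr_wt_invariant : order_invariant lr_wt.
Proof. by move=> g w mono; rewrite /lr_wt lrmin_map // avoid_wt_invariant. Qed.

(** The weight restricted to the words that start with their least letter; as
    opposed to fixing that letter, this is order invariant. *)
Definition min_wt w : R :=
  if w is a :: w1 then if all (ltn a) w1 then avoid_wt w else 0 else 0.

Lemma min_wt_invariant : order_invariant min_wt.
Proof.
move=> g [|a w] // mono.
have -> : min_wt (map g (a :: w)) =
    if all (ltn (g a)) (map g w) then avoid_wt (map g (a :: w)) else 0 by [].
rewrite avoid_wt_invariant // all_map; congr (if _ then _ else _).
by apply: eq_in_all => b bw; rewrite /= mono ?inE ?eqxx ?bw ?orbT.
Qed.

End Weights.

(** * Recurrences for the sums over permutations *)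

Section Recurrences.
Variables (R : comAlgType rat) (x y : R).
Implicit Types (F G : seq nat -> R) (s t u v w : seq nat).

Notation W := (permsum (cluster y)).
Notation V := (permsum (mcluster y)).

Lemma permsum0 F : permsum F 0 = F [::].
Proof. by rewrite /permsum big_seq1. Qed.

Lemma permsum1 F : permsum F 1 = F [:: 0%N].
Proof. by rewrite /permsum big_seq1. Qed.

Lemma permsum_mcluster_small n : (n < 5)%N -> V n = 0.
Proof.
move=> lt_n; rewrite /permsum big_seq big1 // => w /size_perms.
by rewrite size_iota => sw; rewrite mcluster_short ?sw.
Qed.

Lemma all_perms (m : nat) s w :
  all (ltn m) s -> w \in permutations s -> all (ltn m) w.
Proof. by rewrite mem_permutations => ms /perm_all->. Qed.

Lemma nonmin_head (m : nat) s w : all (ltn m) s ->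
  w \in permutations (m :: s) -> index m w != 0%N ->
  exists a v, w = a :: v /\ ~~ all (ltn a) v.
Proof.
move=> ms; rewrite mem_permutations; case: w => [|a v].
  by move/perm_size.
move=> /perm_mem pw /=; case: (eqVneq a m) => // am _; exists a, v; split=> //.
have mv : m \in v.
  by have := pw m; rewrite !inE eqxx /= [m == a]eq_sym (negbTE am).
have : a \in m :: s by rewrite -pw mem_head.
rewrite inE (negbTE am) /= => /(allP ms) /= ma.
by apply/negP => /allP/(_ m mv) /=; lia.
Qed.

Lemma sum_perms_least F m s : uniq (m :: s) -> all (ltn m) s ->
  (forall a v, ~~ all (ltn a) v -> F (a :: v) = 0) ->
  \sum_(w <- permutations (m :: s)) F w = \sum_(w <- permutations s) F (m :: w).
Proof.
move=> us ms F0; apply: sum_perms_head => // w wp /(nonmin_head ms wp).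
by case=> a [v [-> /F0]].
Qed.

Lemma cluster_nonmin a v : ~~ all (ltn a) v -> cluster y (a :: v) = 0.
Proof. by case/(cluster_min y). Qed.

Lemma mcluster_nonmin a v : ~~ all (ltn a) v -> mcluster y (a :: v) = 0.
Proof. by case/(cluster_min y). Qed.

Lemma all_ltn_iota k n m : (k < m)%N -> all (ltn k) (iota m n).
Proof. by move=> km; apply/allP => z; rewrite mem_iota /=; lia. Qed.

(** The first letter is the least one, so the step after it is always an ascent
    and may be a link. *)
Lemma permsum_cluster_rec n : W n.+2 = (1 - y) * W n.+1 + V n.+2.
Proof.
have us : uniq (0%N :: iota 1 n.+1) by rewrite (iota_uniq 0 n.+2).
have ms : all (ltn 0) (iota 1 n.+1) by apply: all_ltn_iota.
rewrite /permsum !(sum_perms_least us ms); first last.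
- exact: cluster_nonmin.
- exact: mcluster_nonmin.
rewrite -[X in _ * X]/(W n.+1) -{2}(size_iota 1 n.+1).
rewrite -(sum_perms_invariant (cluster_invariant y)) ?iota_uniq //.
rewrite mulr_sumr -big_split; apply: eq_big_seq => w ws /=.
have := all_perms ms ws; have := size_perms ws.
case: w {ws} => [|b w] // _ /andP[/= b0 _].
by rewrite clusterE b0.
Qed.

(** A match marked at the first letter puts the two least letters at the first
    and third positions. *)
Lemma sum_mcluster_two (m1 m2 : nat) s : uniq [:: m1, m2 & s] ->
  all (ltn m1) (m2 :: s) -> all (ltn m2) s -> (0 < size s)%N ->
  \sum_(w <- permutations [:: m1, m2 & s]) mcluster y w =
  \sum_(w <- permutations s) mcluster y (m1 :: take 1 w ++ m2 :: drop 1 w).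
Proof.
move=> us ms1 ms2 s0; rewrite (sum_perms_least us ms1 mcluster_nonmin).
have us2 : uniq (m2 :: s) by case/andP: us.
apply: sum_perms_supported => // w ws; apply: contraNeq => nz.
have sw := size_perms ws.
case: w ws sw nz => [|b [|c w]] // ws; first by rewrite /= => -[]; lia.
move=> _ /mcluster_min2 /= /andP[cb mw].
have := ws; rewrite mem_permutations => /perm_mem pw.
have mE : m2 \in [:: b, c & w] by rewrite pw mem_head.
have cm : c = m2.
  have : c \in m2 :: s by rewrite -pw !inE eqxx orbT.
  rewrite inE => /orP[/eqP//|/(allP ms2) /= m2c].
  by move: mE; rewrite !inE => /or3P[/eqP|/eqP|/(allP mw) /=]; lia.
by rewrite -cm (gtn_eqF cb) eqxx.
Qed.

Lemma mulrn_inj n (a b : R) : (0 < n)%N -> a *+ n = b *+ n -> a = b.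
Proof. by case: n => // n _; apply: mulrSn_inj. Qed.

Lemma permsum_const n : permsum (fun=> 1 : R) n = n`!%:R.
Proof.
rewrite /permsum big_const_seq count_predT iter_addr_0 size_permutations.
  by rewrite size_iota.
exact: iota_uniq.
Qed.

Lemma const_invariant : order_invariant (fun=> 1 : R).
Proof. by []. Qed.

Lemma sum_perms_drop G b s i : uniq s -> (i <= size s)%N ->
  (forall t, uniq t -> {subset t <= s} -> size t = (size s - i)%N ->
     \sum_(u <- permutations t) G u = b) ->
  \sum_(w <- permutations s) G (drop i w) = b *+ (size s) ^_ i.
Proof.
move=> us le_is Gb; apply: (@mulrn_inj (i`! * (size s - i)`!)).
  by rewrite muln_gt0 !fact_gt0.
transitivity ((\sum_(w <- permutations s) 1 * G (drop i w))
                *+ (i`! * (size s - i)`!)).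
  by congr (_ *+ _); apply: eq_bigr => w _; rewrite mul1r.
rewrite (@sum_perms_cat _ (fun=> 1) G i`!%:R b) //; last first.
  move=> t ut _ <-; rewrite (sum_perms_invariant const_invariant) //.
  exact: permsum_const.
rewrite mulr_natl -!mulrnA; congr (_ *+ _).
by rewrite -(ffact_fact le_is); lia.
Qed.

(** The letters 0, 1, 2 are at the positions 0, 2, 4, and the others form an
    arbitrary permutation w of p letters. Forgetting the first two letters of w
    (b and d) leaves a cluster with 2 in front, and forgetting the first one (b)
    leaves one that starts with a marked match with 1 and 2 at its positions 0
    and 2. *)
Lemma permsum_mcluster_rec p : (1 < p)%N ->
  V p.+3 = - (y ^+ 2 * (W p.-1 *+ (p * p.-1)) + y * (V p.+1 *+ p)).
Proof.
move=> lt1p; set s := iota 3 p.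
have sE : iota 0 p.+3 = [:: 0, 1, 2 & s]%N by [].
have us : uniq [:: 0, 1, 2 & s]%N by rewrite -sE iota_uniq.
have us2 : uniq (2%N :: s) by rewrite (iota_uniq 2 p.+1).
have us0 : uniq s by rewrite iota_uniq.
have ss : size s = p by rewrite size_iota.
have ms k : (k < 3)%N -> all (ltn k) s by apply: all_ltn_iota.
have ms0 : all (ltn 0) [:: 1, 2 & s]%N by rewrite /= ms.
have ms1 : all (ltn 1) (2%N :: s) by rewrite /= ms.
rewrite {1}/permsum sE sum_mcluster_two //.
rewrite (@sum_perms_supported _ _ _ _ 2) ?ss //; last first.
  move=> w ws; apply: contraNeq => nz.
  have sw := size_perms ws.
  case: w ws sw nz => [|b [|d [|e w]]] // ws; rewrite /= ?ss; try lia.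
  move=> _ /mcluster_min3 /= /and3P[eb ed ew].
  have := ws; rewrite mem_permutations => /perm_mem pw.
  have mE : 2%N \in [:: b, d, e & w] by rewrite pw mem_head.
  have e2 : e = 2%N.
    have : e \in 2%N :: s by rewrite -pw !inE eqxx !orbT.
    rewrite inE => /orP[/eqP//|/(allP (ms 2%N isT)) /= lt2e].
    by move: mE; rewrite !inE => /or4P[/eqP|/eqP|/eqP|/(allP ew) /=]; lia.
  by rewrite e2 in eb ed *; rewrite (gtn_eqF eb) (gtn_eqF ed) eqxx.
pose GV u := mcluster y (1%N :: take 1 u ++ 2%N :: drop 1 u).
transitivity (\sum_(w <- permutations s)
   ((- y ^+ 2) * cluster y (2%N :: drop 2 w) + - y * GV (drop 1 w))).
  apply: eq_big_seq => w ws; have sw := size_perms ws.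
  have := all_perms (ms 2%N isT) ws; rewrite ss in sw.
  case: w ws sw => [|b [|d w]] // ws; rewrite /=; try lia.
  move=> _ /and3P[b2 d2 _]; rewrite /GV /= take0 !drop0 cat0s mclusterE.
  by rewrite /starts_match b2 d2 /= opprD !mulNr.
rewrite big_split /= -!mulr_sumr.
have mt k t : {subset t <= s} -> (k < 3)%N -> all (ltn k) t.
  by move=> ts k3; apply/allP => z /ts /(allP (ms k k3)).
have nt k t : {subset t <= s} -> (k < 3)%N -> k \notin t.
  by move=> ts k3; apply/negP => /ts /(allP (ms k k3)) /=; lia.
rewrite (@sum_perms_drop (fun v => cluster y (2%N :: v)) (W p.-1)) ?ss //;
  last first.
  move=> t ut ts st.
  rewrite -(sum_perms_least _ _ cluster_nonmin) ?(mt 2%N) //; last first.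
    by rewrite /= nt.
  rewrite (sum_perms_invariant (cluster_invariant y)); last by rewrite /= nt.
  by congr permsum; rewrite /= st; lia.
rewrite (@sum_perms_drop GV (V p.+1)) ?ss //; last 2 first.
- by lia.
- move=> t ut ts st; have u12 : uniq [:: 1, 2 & t]%N.
    by rewrite /= !inE /= !nt.
  rewrite -sum_mcluster_two //; last by rewrite st; lia.
  - rewrite (sum_perms_invariant (mcluster_invariant y)) //.
    by congr permsum; rewrite /= st; lia.
  - by rewrite /= mt.
  - exact: mt.
by rewrite ffactn1 !ffactnS ffactn0 muln1 !mulNr opprD.
Qed.

Definition min_count n := permsum (min_wt y) n.+1.

Lemma min_wt_nonmin a v : ~~ all (ltn a) v -> min_wt y (a :: v) = 0.
Proof. by move=> /negbTE nv; rewrite /min_wt nv. Qed.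

(** Cut a permutation at its least letter. *)
Lemma permsum_lr_wt_rec n :
  permsum (lr_wt x y) n.+1 =
  \sum_(i < n.+1) x * (permsum (lr_wt x y) i * min_count (n - i)) *+ 'C(n, i).
Proof.
have us : uniq (0%N :: iota 1 n) by rewrite (iota_uniq 0 n.+1).
have ms : all (ltn 0) (iota 1 n) by apply: all_ltn_iota.
rewrite {1}/permsum [iota _ _]/= sum_perms_insert // exchange_big /= size_iota.
apply: eq_bigr => i _; have le_in : (i <= n)%N by rewrite -ltnS.
transitivity (\sum_(w <- permutations (iota 1 n))
  x * (lr_wt x y (take i w) * avoid_wt y (0%N :: drop i w))).
  apply: eq_big_seq => w ws; have := all_perms ms ws.
  rewrite -{1}(cat_take_drop i w) all_cat => /andP[mt md].
  rewrite /lr_wt lrmin_min_split // avoid_wt_min_split // exprS.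
  by rewrite !mulrA.
rewrite -mulr_sumr -mulrnAr; congr (x * _).
apply: (@mulrn_inj (i`! * (n - i)`!)); first by rewrite muln_gt0 !fact_gt0.
rewrite -mulrnA bin_fact //.
have := @sum_perms_cat R (lr_wt x y) (fun v => avoid_wt y (0%N :: v))
  (permsum (lr_wt x y) i) (min_count (n - i)) (iota 1 n) i.
rewrite size_iota; apply; rewrite ?iota_uniq //.
  by move=> t ut _ <-; apply: sum_perms_invariant => //; apply: lr_wt_invariant.
move=> t ut ts st.
have mt : all (ltn 0) t by apply/allP => z /ts /(allP ms).
have u0 : uniq (0%N :: t).
  by rewrite /= ut andbT; apply/negP => /(allP mt).
rewrite /min_count -st -[(size t).+1]/(size (0%N :: t)).
rewrite -(sum_perms_invariant (@min_wt_invariant R y)) //.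
rewrite (sum_perms_least u0 mt min_wt_nonmin).
apply: eq_big_seq => w ws; rewrite /min_wt.
by rewrite (all_perms mt ws).
Qed.

Lemma permsum_avoid_wt n :
  permsum (avoid_wt y) n.+1 =
  \sum_(i < n.+2) (W i * permsum (avoid_wt y) (n.+1 - i)) *+ 'C(n.+1, i).
Proof.
transitivity (\sum_(w <- permutations (iota 0 n.+1))
   deconcat (cluster y) (avoid_wt y) w).
  apply: eq_big_seq => w /size_perms sw.
  by rewrite (deconcat_avoid y w).1; case: w sw.
transitivity (\sum_(w <- permutations (iota 0 n.+1)) \sum_(i < n.+2)
   cluster y (take i w) * avoid_wt y (drop i w)).
  by apply: eq_big_seq => w /size_perms sw; rewrite deconcatE sw size_iota.
rewrite exchange_big; apply: eq_bigr => i _ /=.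
have le_in : (i <= n.+1)%N by rewrite -ltnS.
apply: (@mulrn_inj (i`! * (n.+1 - i)`!)); first by rewrite muln_gt0 !fact_gt0.
rewrite -mulrnA bin_fact //.
have := @sum_perms_cat R (cluster y) (avoid_wt y)
  (W i) (permsum (avoid_wt y) (n.+1 - i)) (iota 0 n.+1) i.
rewrite size_iota; apply; rewrite ?iota_uniq //.
  move=> t ut _ <-; apply: sum_perms_invariant => //; exact: cluster_invariant.
move=> t ut _ <-; apply: sum_perms_invariant => //; exact: avoid_wt_invariant.
Qed.

End Recurrences.

(** * Matches, descents and minima of a permutation *)

Section Words.
Implicit Types (u v w : seq nat).

Lemma index_sorted_count w a : sorted ltn w -> a \in w ->
  index a w = count (fun b => b < a)%N w.
Proof.
elim: w => // b w IHw /= pw; rewrite inE.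
have mw : all (ltn b) w.
  by move: pw; rewrite (path_sortedE ltn_trans) => /andP[].
case: (eqVneq a b) => [-> _|ab /= aw].
  rewrite ltnn (@eq_in_count _ _ pred0) ?count_pred0 //.
  by move=> c /(allP mw) /=; lia.
rewrite IHw ?(path_sorted pw) //.
by have /= -> := allP mw _ aw.
Qed.

Lemma redE w : uniq w -> red w = [seq (count (fun b => b < a)%N w).+1 | a <- w].
Proof.
move=> uw; apply/eq_in_map => a aw; rewrite index_sorted_count ?mem_sort //.
  by rewrite (seq.permP (permEl (perm_sort leq w))).
by rewrite ltn_sorted_uniq_leq sort_uniq uw sort_sorted //; apply: leq_total.
Qed.

Lemma red_Gamma0 a b c d e : uniq [:: a; b; c; d; e] ->
  (red [:: a; b; c; d; e] \in Gamma0) = [&& a < c, c < e, e < b & e < d]%N.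
Proof.
move=> uw; rewrite redE // /Gamma0 !inE /= !ltnn !add0n !addn0.
move: uw; rewrite /= !inE !negb_or !andbT.
move=> /and4P[/and4P[ab ac _ ae] /and3P[_ bd be] /andP[_ ce] de].
apply/idP/idP.
  move=> H; have [ra rc re] : [/\ (b < a) + ((c < a) + ((d < a) + (e < a))) = 0,
      (a < c) + ((b < c) + ((d < c) + (e < c))) = 1 &
      (a < e) + ((b < e) + ((c < e) + (d < e))) = 2]%N.
    by case/orP: H => /eqP[].
  clear H; have [ltac ltae] : (a < c /\ a < e)%N by clear rc re; lia.
  rewrite ltac; have ltce : (c < e)%N by clear ra re; lia.
  rewrite ltce; have [-> ->] // : (e < b /\ e < d)%N by clear ra rc; lia.
move=> /and4P[ltac ltce lteb lted].
have lt p q : (p < q)%N -> ((p < q)%N = true) * ((q < p)%N = false).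
  by move=> pq; rewrite pq ltnNge ltnW.
have ltae := ltn_trans ltac ltce.
rewrite !(lt _ _ ltac, lt _ _ ltce, lt _ _ lteb, lt _ _ lted, lt _ _ ltae).
rewrite !(lt _ _ (ltn_trans ltae lteb), lt _ _ (ltn_trans ltae lted)).
rewrite !(lt _ _ (ltn_trans ltce lteb), lt _ _ (ltn_trans ltce lted)).
by case: (ltngtP b d) bd.
Qed.

(** The two patterns have length 5, which forces the end of the match. *)
Lemma match_atE w i : uniq w -> match_at Gamma0 w i = starts_match (drop i w).
Proof.
move=> uw; apply/existsP/idP.
  case=> j /andP[lt_ij]; set f := factor w i j => fG.
  have sf : size f = (j - i).+1.
    rewrite /f /factor size_takel // size_drop.
    by case: j lt_ij {f fG} => /=; lia.
  have uf : uniq f by rewrite take_uniq ?drop_uniq.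
  have s5 : size f = 5.
    suff : size (red f) = 5 by rewrite size_map.
    by move: fG; rewrite !inE => /orP[] /eqP->.
  have fE : f = take 5 (drop i w) by rewrite /f /factor -[X in take X _]sf s5.
  move: uf fG s5; rewrite fE; case: (drop i w) => [|a [|b [|c [|d [|e v]]]]] //.
  by rewrite [take _ _]/= take0 => /red_Gamma0->.
move=> m.
have lt5 : (4 < size (drop i w))%N.
  by move: m; case: (drop i w) => [|a [|b [|c [|d [|e v]]]]].
have ltj : (i + 4 < size w)%N by move: lt5; rewrite size_drop; lia.
exists (Ordinal ltj) => /=; rewrite -[X in (X < _)%N]addn0 ltn_add2l /=.
have := drop_uniq i uw; rewrite /factor addKn.
move: m; case: (drop i w) => [|a [|b [|c [|d [|e v]]]]] // m uv.
rewrite [take _ _]/= take0 red_Gamma0 //.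
by move: uv; rewrite -[_ :: _]/([:: a; b; c; d; e] ++ v) cat_uniq => /andP[].
Qed.

Lemma LRminE w : LRmin w = lrmin w.
Proof.
rewrite /LRmin /lrmin -sum1_card big_mkcond big_mkord.
apply: eq_bigr => j _; rewrite inE.
set p := [forall i, _]; have -> : p = all (fun b => nth 0 w j < b)%N (take j w).
  have sj : size (take j w) = j by rewrite size_takel // ltnW.
  apply/forallP/(all_nthP 0%N) => [H i|H i].
    rewrite sj => lt_ij; have lt_i := ltn_trans lt_ij (ltn_ord j).
    by have /implyP/(_ lt_ij) := H (Ordinal lt_i); rewrite nth_take.
  apply/implyP => lt_ij; have := H i; rewrite sj nth_take //.
  by apply.
by case: all.
Qed.

Lemma desE w :
  des w = (\sum_(i < (size w).-1) (nth 0 w i.+1 < nth 0 w i))%N.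
Proof.
rewrite /des -sum1_card big_mkcond; apply: eq_bigr => i _.
by rewrite inE; case: ltnP.
Qed.

Lemma des_cons a b w : des [:: a, b & w] = ((b < a) + des (b :: w))%N.
Proof. by rewrite !desE big_ord_recl. Qed.

Lemma avoid_wtE_des (R : comAlgType rat) (y : R) w : uniq w -> w != [::] ->
  avoid_wt y w =
  if all (fun i => ~~ match_at Gamma0 w i) (iota 0 (size w))
  then y ^+ (1 + des w) else 0.
Proof.
move=> uw wn0.
rewrite (@eq_all _ _ (fun i => ~~ starts_match (drop i w))); last first.
  by move=> i; rewrite match_atE.
elim: w uw wn0 => // a [|b w] IHw uw _.
  by rewrite /des /= -sum1_card big_ord0 expr1.
have /andP[] := uw; rewrite inE negb_or => /andP[ab _] uw1.
rewrite avoid_wtE IHw // des_cons.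
have -> : iota 0 (size [:: a, b & w]) =
    0%N :: map succn (iota 0 (size (b :: w))).
  by rewrite -(iotaDl 1).
rewrite -[0%N :: _]cat1s all_cat all_seq1 all_map.
rewrite drop0; case: (starts_match _) => //; rewrite andTb.
rewrite [X in _ = if X then _ else _](@eq_all _ _
  (fun i => ~~ starts_match (drop i (b :: w)))) //.
case: (all _ _); last by rewrite mulr0.
by case: ltngtP ab => // _ _; rewrite ?mul1r // -exprS.
Qed.

Lemma perm_words n :
  perm_eq [seq word s | s <- index_enum 'S_n] (permutations (iota 1 n)).
Proof.
have inj : injective (@word n).
  move=> s t /eq_in_map st; apply/permP => i.
  by apply/val_inj/succn_inj/st; rewrite mem_enum.
have um : uniq [seq word s | s <- index_enum 'S_n].
  by rewrite map_inj_uniq // index_enum_uniq.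
have sub : {subset [seq word s | s <- index_enum 'S_n] <=
            permutations (iota 1 n)}.
  move=> _ /mapP[s _ ->]; rewrite mem_permutations /word.
  have -> : iota 1 n = [seq (val i).+1 | i <- enum 'I_n].
    by rewrite (iotaDl 1 0) -val_enum_ord -map_comp.
  rewrite (map_comp (fun i : 'I_n => (val i).+1) s); apply: perm_map.
  apply: uniq_perm; last first.
  - move=> i; rewrite mem_enum; apply/mapP; exists (s^-1%g i).
      by rewrite mem_enum.
    by rewrite permKV.
  - exact: enum_uniq.
  by rewrite (map_inj_uniq perm_inj) enum_uniq.
apply: uniq_perm => //; first exact: permutations_uniq.
apply: (uniq_min_size um sub _).2.
rewrite size_permutations ?iota_uniq // size_iota size_map -card_Sn.
rewrite -sum1_card -sum1_size big_mkcond.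
by apply: leq_sum => s _.
Qed.
End Words.

(** * Exponential generating functions *)

Section GeneratingFunctions.
Variables (R : comAlgType rat) (x y : R).

Notation W := (permsum (cluster y)).
Notation V := (permsum (mcluster y)).

Definition egf (a : nat -> R) : series R := fun n => (n`!%:R^-1 : rat) *: a n.

Lemma sderiv_egf a : sderiv (egf a) = egf (fun n => a n.+1).
Proof.
apply: functional_extensionality => n; rewrite /sderiv /egf.
rewrite scalerMnl factS natrM invfM -[_ *+ _]mulr_natr mulrAC.
by rewrite mulVf ?pnatr_eq0 // mul1r.
Qed.

Lemma smul_egf a b :
  smul (egf a) (egf b) =
  egf (fun n => \sum_(i < n.+1) (a i * b (n - i)%N) *+ 'C(n, i)).
Proof.
apply: functional_extensionality => n; rewrite /smul /egf scaler_sumr.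
apply: eq_bigr => i _; have le_in : (i <= n)%N by rewrite -ltnS.
rewrite -scalerAl -scalerAr scalerA -scaler_nat scalerA; congr (_ *: _).
rewrite -(bin_fact le_in) !natrM.
have nzf k : k`!%:R != 0 :> rat by rewrite pnatr_eq0 -lt0n fact_gt0.
have nzb : 'C(n, i)%:R != 0 :> rat by rewrite pnatr_eq0 -lt0n bin_gt0.
by field; rewrite !nzf nzb.
Qed.

Lemma egf_avoid_inv :
  smul (fun n => sone R n - egf W n) (egf (permsum (avoid_wt y))) = sone R.
Proof.
set N := egf (permsum (avoid_wt y)).
have NE : N = fun n => sone R n + smul (egf W) N n.
  apply: functional_extensionality => -[|n].
    rewrite /smul big_ord1 /N /egf !permsum0 /= fact0 invr1 !scale1r.
    by rewrite mul0r addr0.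
  by rewrite /N smul_egf add0r /egf -permsum_avoid_wt.
have -> : (fun n => sone R n - egf W n) =
    (fun n => sone R n + sscale (-1) (egf W) n).
  by apply: functional_extensionality => n; rewrite /sscale mulN1r.
rewrite smulDl smul1s smul_scalel; apply: functional_extensionality => n.
by rewrite {1}NE /sscale mulN1r addrK.
Qed.

Lemma sderiv_egf_lr c :
  sderiv (egf (permsum (lr_wt c y))) =
  sscale c (smul (egf (min_count y)) (egf (permsum (lr_wt c y)))).
Proof.
rewrite sderiv_egf smulC smul_egf; apply: functional_extensionality => n.
rewrite /egf /sscale permsum_lr_wt_rec -scalerAr; congr (_ *: _).
by rewrite mulr_sumr; apply: eq_bigr => i _; rewrite mulrnAr.
Qed.

Lemma lr_wt1 : lr_wt 1 y = avoid_wt y.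
Proof.
by apply: functional_extensionality => w; rewrite /lr_wt expr1n mul1r.
Qed.

Lemma egf_lr0 c : egf (permsum (lr_wt c y)) 0 = 1.
Proof.
by rewrite /egf permsum0 /lr_wt /lrmin big_nil fact0 invr1 scale1r mulr1.
Qed.

Lemma egf_lr_srpow (u : series R) : u = (fun n => sone R n - egf W n) ->
  egf (permsum (lr_wt x y)) =1 srpow (sinv u) x.
Proof.
move=> uE.
have -> : sinv u = egf (permsum (avoid_wt y)).
  apply: sinv_of_smul; last by rewrite uE egf_avoid_inv.
  by rewrite uE /egf permsum0 scaler0 subr0.
apply: (@srpow_of_sderiv _ _ _ (egf (min_count y))).
- exact: egf_lr0.
- by rewrite -lr_wt1 egf_lr0.
- exact: sderiv_egf_lr.
rewrite -lr_wt1 sderiv_egf_lr; apply: functional_extensionality => n.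
by rewrite /sscale mul1r.
Qed.

(** Unfold the recurrence of V twice and replace the last occurrence of V, which
    has index m + 2, by W_(m+2) - (1 - y) W_(m+1). *)
Lemma permsum_cluster_closed m :
  W m.+4.+2 = (1 - y) * W m.+4.+1
    - y ^+ 2 * m.+3%:R * (W m.+2 + (1 - y) * m.+1%:R * W m.+1)
    + y ^+ 3 * (m.+3 * m.+1 * m)%:R * W m.
Proof.
have rV p : V p.+3 = - (y ^+ 2 * (W p.-1 *+ (p * p.-1)) + y * (V p.+1 *+ p)).
  (* For p < 2 the general formula still holds: both sides vanish. *)
  case: p => [|[|p]]; last exact: permsum_mcluster_rec.
  - by rewrite permsum_mcluster_small // !mulr0n !mulr0 addr0 oppr0.
  - by rewrite !permsum_mcluster_small // mulr0n mul0rn !mulr0 addr0 oppr0.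
rewrite permsum_cluster_rec rV /= rV /=.
have -> : V m.+2 = W m.+2 - (1 - y) * W m.+1.
  by rewrite permsum_cluster_rec addrC addKr.
by ring.
Qed.

(** For n >= 6 all the indices in the recursion are nonnegative and the closed
    recurrence of W applies; at index 0 the two conventions agree, as the empty
    word carries no cluster. For n < 6 the terms of nonpositive index vanish. *)
Lemma recursion_solution (U : int -> R) :
  (forall m : int, m <= 0 -> U m = 0) -> U 1 = - y ->
  (forall n : int, 2 <= n ->
    U n = (1 - y) * U (n - 1)
          - y ^+ 2 * (n - 3)%:~R
              * (U (n - 4) + (1 - y) * (n - 5)%:~R * U (n - 5))
          + y ^+ 3 * ((n - 3) * (n - 5) * (n - 6))%:~R * U (n - 6)) ->
  forall n : nat, U n%:Z = - W n.
Proof.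
move=> U_le0 U1 U_rec.
have W0 : W 0 = 0 by rewrite permsum0.
have W1 : W 1 = y by rewrite permsum1.
have W2 : W 2 = (1 - y) * y.
  by rewrite permsum_cluster_rec permsum_mcluster_small // W1 addr0.
have W3 : W 3 = (1 - y) * W 2.
  by rewrite permsum_cluster_rec permsum_mcluster_small // addr0.
have W4 : W 4 = (1 - y) * W 3.
  by rewrite permsum_cluster_rec permsum_mcluster_small // addr0.
have W5 : W 5 = (1 - y) * W 4 - y ^+ 2 * y *+ 2.
  rewrite permsum_cluster_rec permsum_mcluster_rec //=.
  by rewrite (@permsum_mcluster_small _ _ 3) // W1 mul0rn mulr0 addr0 mulrnAr.
have U0 : U 0 = 0 by apply: U_le0.
have UN k : U (Negz k) = 0 by apply: U_le0.
have U2 : U 2 = - W 2.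
  rewrite U_rec // -[2 - 1]/(1 : int) -[2 - 4]/(Negz 1) -[2 - 5]/(Negz 2).
  by rewrite -[2 - 6]/(Negz 3) !UN U1 W2; ring.
have U3 : U 3 = - W 3.
  rewrite U_rec // -[3 - 1]/(2 : int) -[3 - 4]/(Negz 0) -[3 - 5]/(Negz 1).
  by rewrite -[3 - 6]/(Negz 2) !UN U2 W3; ring.
have U4 : U 4 = - W 4.
  rewrite U_rec // -[4 - 1]/(3 : int) -[4 - 4]/(0 : int) -[4 - 5]/(Negz 0).
  by rewrite -[4 - 6]/(Negz 1) !UN U0 U3 W4; ring.
have U5 : U 5 = - W 5.
  rewrite U_rec // -[5 - 1]/(4 : int) -[5 - 4]/(1 : int) -[5 - 5]/(0 : int).
  rewrite -[5 - 6]/(Negz 0) -[5 - 3]/(2 : int) !UN U0 U1 U4 W5.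
  by ring.
elim/ltn_ind => -[|[|[|[|[|[|m]]]]]] // IH; rewrite ?W0 ?oppr0 ?W1 //.
rewrite U_rec //.
have -> : m.+4.+2%:Z - 1 = m.+4.+1 by lia.
have -> : m.+4.+2%:Z - 3 = m.+3 by lia.
have -> : m.+4.+2%:Z - 4 = m.+2 by lia.
have -> : m.+4.+2%:Z - 5 = m.+1 by lia.
have -> : m.+4.+2%:Z - 6 = m by lia.
rewrite !IH //; try lia.
rewrite permsum_cluster_closed -!PoszM -!pmulrn; ring.
Qed.

End GeneratingFunctions.

(** * The generating function of the avoiding permutations *)

Lemma NMpolyE n : (0 < n)%N -> NMpoly Gamma0 n = permsum (lr_wt vx vy) n.
Proof.
move=> n_gt0; rewrite -{2}(size_iota 1 n).
rewrite -(sum_perms_invariant (@lr_wt_invariant _ vx vy)) ?iota_uniq //.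
rewrite -(perm_big _ (perm_words n)) big_map /NMpoly big_mkcond.
apply: eq_bigr => s _; rewrite inE /lr_wt -LRminE.
have sw : size (word s) = n by rewrite size_map size_enum_ord.
have uw : uniq (word s).
  by rewrite map_inj_uniq ?enum_uniq // => i j [] /val_inj/perm_inj.
rewrite avoid_wtE_des //; last by rewrite -size_eq0 sw -lt0n.
rewrite sw; have -> : [forall i : 'I_n, ~~ match_at Gamma0 (word s) i] =
    all (fun i => ~~ match_at Gamma0 (word s) i) (iota 0 n).
  apply/forallP/allP => [H i|H i].
    by rewrite mem_iota /= => lt_in; apply: (H (Ordinal lt_in)).
  by apply: H; rewrite mem_iota /=.
by case: (all _ _); rewrite ?mulr0.
Qed.

Unset Implicit Arguments.

Theorem theorem2 (U : int -> Qxy)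
  (U_le0 : forall m : int, m <= 0 -> U m = 0)
  (U_1 : U 1 = - vy)
  (U_rec : forall n : int, 2 <= n ->
    U n = (1 - vy) * U (n - 1)
          - vy ^+ 2 * (n - 3)%:~R
              * (U (n - 4) + (1 - vy) * (n - 5)%:~R * U (n - 5))
          + vy ^+ 3 * ((n - 3) * (n - 5) * (n - 6))%:~R * U (n - 6)) :
  NM Gamma0 =1 srpow (sinv (egf1 (fun n : nat => U n%:Z))) vx.
Proof.
have UE := recursion_solution U_le0 U_1 U_rec.
have NE : NM Gamma0 =1 egf (permsum (lr_wt vx vy)).
  case=> [|n]; first by rewrite egf_lr0.
  by rewrite /NM /egf1 NMpolyE.
move=> n; rewrite NE; apply: egf_lr_srpow.
apply: functional_extensionality => -[|k].
  by rewrite /egf permsum0 scaler0 subr0.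
by rewrite /egf1 /egf /sone UE scalerN add0r.
Qed.
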